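(* Let $f\in C^2(\mathbb{R}^d,\mathbb{R}^d)$ and let $x(t)$, $t\ge0$, be a nonconstant bounded solution of $\dot x(t)=f(x(t))$. Let $V_0=\mathrm{span}(\dot x(0))$. Then there exist constants $C,h_0>0$ such that $$\big|\alpha_1^{\mathrm{cont}}(T,V_0)-\alpha_1^{\mathrm{diff}}(h,T,V_0)\big|\le C h$$ for all $T>0$ and $h=\frac TN\le h_0$ (with $N\in\mathbb{N}$).
   Context: For nonzero vectors $v,w\in\mathbb{R}^d$, $\measuredangle(v,w)=\arccos\big(\frac{|v^\top w|}{\|v\|\|w\|}\big)\in[0,\frac\pi2]$ (the principal angle between $\mathrm{span}(v)$ and $\mathrm{span}(w)$). $P_V$ is the orthogonal projector onto a subspace $V$ and $\|\cdot\|$ the Euclidean/spectral norm. $\Phi(t,\tau)$ is the solution operator of the variational equation $\dot u(t)=A(t)u(t)$, $A(t)=Df(x(t))$, along the solution $x$. For $T>0$, $$\alpha_1^{\mathrm{cont}}(T,V_0)=\frac1T\int_0^T\big\|(I_d-P_{\Phi(t,0)V_0})A(t)P_{\Phi(t,0)V_0}\big\|\,dt,$$ $$\alpha_1^{\mathrm{diff}}(h,T,V_0)=\frac1T\sum_{j=1}^{N}\measuredangle\big(x((j-1)h)-x(jh),\ x(jh)-x((j+1)h)\big),\qquad h=\frac TN.$$ *)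

(* Defs.v *)
From HB Require Import structures.
From mathcomp Require Import all_boot all_order all_algebra.
From mathcomp Require Import all_classical all_reals all_analysis.
Import Order.TTheory GRing.Theory Num.Theory.
Import numFieldNormedType.Exports.

Set Implicit Arguments.
Unset Strict Implicit.
Unset Printing Implicit Defensive.

Local Open Scope classical_set_scope.
Local Open Scope ring_scope.

(* [`|v|] on ['cV[R]_d] is the library's max norm: it is used below only for
   the topology and for boundedness.  Lengths, angles and operator norms are
   Euclidean. *)
Section Euclidean.
Context {R : realType} {d : nat}.
Implicit Types v w : 'cV[R]_d.

Definition dotv v w : R := (v^T *m w) 0 0.

Definition enorm v : R := Num.sqrt (dotv v v).

(* Meant for nonzero [v] and [w]; if one of them vanishes, the value is
   [acos 0 = pi / 2]. *)
Definition vangle v w : R := acos (`|dotv v w| / (enorm v * enorm w)).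

(* The unit ball rather than the unit sphere, so that the supremum is over a
   nonempty set also when [d = 0]. *)
Definition opnorm (L : 'End('cV[R]_d)) : R :=
  sup [set enorm (L u) | u in [set u | enorm u <= 1]].

Definition orthocompl (V : {vspace 'cV[R]_d}) : {vspace 'cV[R]_d} :=
  (\bigcap_(w <- vbasis V) lker (linfun (mulmx w^T : 'cV[R]_d -> 'M[R]_1)))%VS.

Definition orthoproj (V : {vspace 'cV[R]_d}) : 'End('cV[R]_d) :=
  daddv_pi V (orthocompl V).

Lemma orthocomplP (V : {vspace 'cV[R]_d}) v :
  reflect (forall w, w \in V -> dotv w v = 0) (v \in orthocompl V).
Proof.
apply: (iffP idP) => [|vV].
  rewrite /orthocompl big_tnth => /subv_bigcapP vV w wV.
  rewrite (coord_vbasis wV) /dotv linear_sum mulmx_suml summxE big1// => i _.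
  have /= := vV (cast_ord (esym (size_tuple (vbasis V))) i) isT.
  rewrite -memvE memv_ker lfunE/= => /eqP/matrixP/(_ 0 0) vi.
  rewrite linearZ/= -scalemxAl mxE; apply/eqP; rewrite mulf_eq0.
  by move: vi; rewrite [X in _ = X]mxE (tnth_nth 0)/= => ->; rewrite eqxx orbT.
rewrite /orthocompl big_tnth; apply/subv_bigcapP => i _.
rewrite -memvE memv_ker lfunE/=; apply/eqP/matrixP => a b.
by rewrite !ord1 [RHS]mxE; apply/vV/vbasis_mem/mem_tnth.
Qed.

Lemma orthocompl_disjoint (V : {vspace 'cV[R]_d}) :
  (V :&: orthocompl V = 0)%VS.
Proof.
apply/eqP; rewrite -subv0; apply/subvP => v.
rewrite memv_cap => /andP[vV /orthocomplP/(_ _ vV)].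
rewrite /dotv mxE => vv0; rewrite memv0; apply/eqP/matrixP => i j.
have : \sum_(k < d) v k 0 ^+ 2 = 0.
  by rewrite -[RHS]vv0; apply: eq_bigr => k _; rewrite mxE expr2.
move/psumr_eq0P => /(_ (fun k _ => sqr_ge0 _))/(_ i isT)/eqP.
by rewrite sqrf_eq0 !ord1 mxE => /eqP.
Qed.

Lemma addv_orthocompl (V : {vspace 'cV[R]_d}) : (V + orthocompl V = fullv)%VS.
Proof.
apply/eqP; rewrite eqEdim subvf/= dimv_disjoint_sum ?orthocompl_disjoint//.
rewrite /orthocompl -[X in (X + _)%N](size_tuple (vbasis V)).
elim: (tval (vbasis V)) => [|w s ih]; first by rewrite big_nil.
rewrite big_cons capvC; apply: (leq_trans ih); move: (bigop.body _ _ _) => U.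
rewrite /= addSnnS leq_add2l.
rewrite -(limg_ker_dim (linfun (mulmx w^T : 'cV[R]_d -> 'M[R]_1)) U) addnC.
by rewrite -[leqRHS]add1n leq_add2r (leq_trans (dimvS (subvf _)))// dimvf.
Qed.

Lemma orthoprojP (V : {vspace 'cV[R]_d}) v :
  orthoproj V v \in V /\ v - orthoproj V v \in orthocompl V.
Proof.
have := @daddv_pi_add _ _ V (orthocompl V) v (orthocompl_disjoint V).
rewrite addv_orthocompl memvf => /(_ isT) vE; split; first exact: memv_pi.
by rewrite -{1}vE addrAC subrr add0r memv_pi.
Qed.

End Euclidean.

(* On a finite-dimensional [V], continuity of all the iterated directional
   derivatives is continuity of the iterated differentials. *)
Fixpoint Ck {R : realType} {V W : normedModType R} (k : nat) (g : V -> W) :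
    Prop :=
  if k is k'.+1 then
    (forall p, differentiable g p) /\ (forall v, Ck k' (fun p => 'D_v g p))
  else continuous g.

(* Derivatives along the half-line [0, +oo[: two-sided at [t > 0], one-sided
   at [t = 0].  Values of [u] at negative times play no role. *)
Section HalfLine.
Context {R : realType} {V : normedModType R}.

Definition quotient_ge0 (u : R -> V) (t s : R) : V :=
  (s - t)^-1 *: (u s - u t).

Definition is_derive_ge0 (u : R -> V) (t : R) (v : V) : Prop :=
  quotient_ge0 u t s @[s --> within `[0, +oo[ t^'] --> v.

Definition derive_ge0 (u : R -> V) (t : R) : V :=
  lim (quotient_ge0 u t s @[s --> within `[0, +oo[ t^']).

End HalfLine.

Section Dynamics.
Context {R : realType} {d : nat}.

Definition is_solution (f : 'cV[R]_d -> 'cV[R]_d) (x : R -> 'cV[R]_d) : Prop :=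
  forall t, 0 <= t -> is_derive_ge0 x t (f (x t)).

Definition variational (f : 'cV[R]_d -> 'cV[R]_d) (x : R -> 'cV[R]_d) (t : R) :
    'End('cV[R]_d) :=
  linfun ('d f (x t)).

Definition is_solution_operator (A : R -> 'End('cV[R]_d))
    (Phi : R -> R -> 'End('cV[R]_d)) : Prop :=
  forall tau u0, 0 <= tau ->
    Phi tau tau u0 = u0 /\
    forall t, 0 <= t ->
      is_derive_ge0 (fun s => Phi s tau u0) t (A t (Phi t tau u0)).

Definition alpha1_cont (A : R -> 'End('cV[R]_d))
    (Phi : R -> R -> 'End('cV[R]_d)) (T : R) (V0 : {vspace 'cV[R]_d}) : R :=
  T^-1 * \int[lebesgue_measure]_(t in `[0, T])
    (let P := orthoproj (Phi t 0 @: V0) in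
     opnorm ((\1 - P) \o A t \o P)%VF).

(* The subspace [V0] enters only through the trajectory [x]. *)
Definition alpha1_diff (x : R -> 'cV[R]_d) (h T : R) (N : nat) : R :=
  T^-1 * \sum_(1 <= j < N.+1)
    vangle (x ((j%:R - 1) * h) - x (j%:R * h))
           (x (j%:R * h) - x ((j%:R + 1) * h)).

End Dynamics.

(* Main.v *)
Require Import Defs.
From HB Require Import structures.
From mathcomp Require Import all_boot all_order all_algebra.
From mathcomp Require Import all_classical all_reals all_analysis.
From mathcomp Require Import ring lra.
Import Order.TTheory GRing.Theory Num.Theory.
Import numFieldNormedType.Exports.

(** The velocity [v t = f (x t)] solves the variational equation [v' = A v], so the
solution operator carries [span (v 0)] to [span (v t)]
([solution_operator_velocity]).  Projecting onto a line, the integrand of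
[alpha1_cont] is the length of the component of [A v] orthogonal to [v], divided by
the length of [v] ([opnorm_cross]); as [A v] is the acceleration [w], this is the
speed [turning_rate] at which the direction of the velocity turns.  On the other
side, the angle between two consecutive chords of the orbit around time [t] is
[h] times the turning rate at [t] up to [O(h ^+ 2)] ([chord_angle]), so [alpha1_diff]
is a Riemann sum for [alpha1_cont] up to [O(h)].

The point is that the constants are uniform in [t] although the velocity may come
arbitrarily close to zero.  On a bounded orbit [A] is bounded by some [L] and, as [f]
is twice continuously differentiable, Lipschitz in time.  By Gronwall's inequality
the velocity never vanishes, changes at most by a factor of two over times shorter
than [1 / (4 * L)], and all Taylor remainders of [x], [v] and [w] near [t] are bounded
by multiples of [enorm (v t)].  Angles only see relative errors, so this is
enough.

Angles are handled through the area [area v w] of the parallelogram spanned by two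
vectors.  The sine of the angle is the area divided by the lengths, and the turning
rate is [area v w / dotv v v].  The area is Lipschitz in each vector and
invariant under shears, so the area of two consecutive chords equals that of the
first chord and the second difference of [x]; comparing this with the area of
[h *: v] and [h ^+ 2 *: w] is [sine_perturbation].  The same lemma shows that the
turning rate is Lipschitz ([turning_rate_lip]), which controls the error of the
Riemann sum. *)

Local Open Scope classical_set_scope.
Local Open Scope ring_scope.

Set Implicit Arguments.
Unset Strict Implicit.

(** * Inner product, norm and area in Euclidean space *)

Lemma le_of_eq {R : realType} (a b : R) : a = b -> a <= b.
Proof. by move->. Qed.

Section EuclideanGeometry.
Context {R : realType} {d : nat}.
Implicit Types (a : R) (u v w : 'cV[R]_d).

Lemma dotvE v w : dotv v w = \sum_i v i 0 * w i 0.
Proof. by rewrite /dotv mxE; apply: eq_bigr => i _; rewrite mxE. Qed.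

Lemma dotvC v w : dotv v w = dotv w v.
Proof. by rewrite !dotvE; apply: eq_bigr => i _; rewrite mulrC. Qed.

Lemma dotvDl u v w : dotv (u + v) w = dotv u w + dotv v w.
Proof. by rewrite /dotv linearD mulmxDl mxE. Qed.

Lemma dotvZl a v w : dotv (a *: v) w = a * dotv v w.
Proof. by rewrite /dotv linearZ -scalemxAl mxE. Qed.

Lemma dotvNl v w : dotv (- v) w = - dotv v w.
Proof. by rewrite -scaleN1r dotvZl mulN1r. Qed.

Lemma dotvDr u v w : dotv u (v + w) = dotv u v + dotv u w.
Proof. by rewrite dotvC dotvDl !(dotvC u). Qed.

Lemma dotvZr a v w : dotv v (a *: w) = a * dotv v w.
Proof. by rewrite dotvC dotvZl dotvC. Qed.

Lemma dotvNr v w : dotv v (- w) = - dotv v w.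
Proof. by rewrite dotvC dotvNl dotvC. Qed.

Lemma dot0v w : dotv 0 w = 0.
Proof. by rewrite -(scale0r 0) dotvZl mul0r. Qed.

Definition dotvl := (dotvDl, dotvDr, dotvNl, dotvNr, dotvZl, dotvZr).

Lemma dotvv_ge0 v : 0 <= dotv v v.
Proof. by rewrite dotvE sumr_ge0// => i _; rewrite -expr2 sqr_ge0. Qed.

Lemma dotvv_eq0 v : (dotv v v == 0) = (v == 0).
Proof.
apply/idP/eqP => [|->]; last by rewrite dot0v.
rewrite dotvE psumr_eq0 => [/allP v0|i _]; last by rewrite -expr2 sqr_ge0.
apply/matrixP => i j; rewrite !ord1 mxE.
by have := v0 i (mem_index_enum i); rewrite mulf_eq0 orbb => /eqP.
Qed.

Lemma enorm_ge0 v : 0 <= enorm v. Proof. exact: sqrtr_ge0. Qed.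

Lemma sqr_enorm v : enorm v ^+ 2 = dotv v v.
Proof. by rewrite sqr_sqrtr// dotvv_ge0. Qed.

Lemma enorm_gt0 v : (0 < enorm v) = (v != 0).
Proof. by rewrite lt0r enorm_ge0 andbT sqrtr_eq0 -ltNge lt0r dotvv_ge0 andbT dotvv_eq0. Qed.

Lemma enorm0 : enorm (0 : 'cV[R]_d) = 0.
Proof. by rewrite /enorm dot0v sqrtr0. Qed.

Lemma enormZ a v : enorm (a *: v) = `|a| * enorm v.
Proof. by rewrite /enorm dotvZl dotvZr mulrA -expr2 sqrtrM ?sqr_ge0// sqrtr_sqr. Qed.

Lemma enormN v : enorm (- v) = enorm v.
Proof. by rewrite -scaleN1r enormZ normrN1 mul1r. Qed.

Lemma enormB v w : enorm (v - w) = enorm (w - v).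
Proof. by rewrite -enormN opprB. Qed.

(** The Gram determinant of [v] and [w], which is the squared area of the
parallelogram that they span. *)
Definition areasq v w := dotv v v * dotv w w - dotv v w ^+ 2.

Lemma areasq_perp v w : dotv v v * areasq v w =
  dotv (dotv v v *: w - dotv v w *: v) (dotv v v *: w - dotv v w *: v).
Proof. by rewrite /areasq !dotvl (dotvC w v); ring. Qed.

(** This is the Cauchy-Schwarz inequality: up to the factor [dotv v v], the Gram
determinant is the squared length of the component of [w] orthogonal to [v]. *)
Lemma areasq_ge0 v w : 0 <= areasq v w.
Proof.
have [->|v0] := eqVneq v 0; first by rewrite /areasq !dot0v expr0n/= mul0r subrr.
rewrite -(pmulr_rge0 (x := dotv v v)); last by rewrite lt0r dotvv_eq0 v0 dotvv_ge0.
by rewrite areasq_perp dotvv_ge0.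
Qed.

Lemma normr_dotv_le v w : `|dotv v w| <= enorm v * enorm w.
Proof.
rewrite -ler_sqr ?nnegrE ?mulr_ge0 ?enorm_ge0// exprMn !sqr_enorm.
by rewrite real_normK ?num_real// -subr_ge0; exact: areasq_ge0.
Qed.

Lemma enormD v w : enorm (v + w) <= enorm v + enorm w.
Proof.
rewrite -ler_sqr ?nnegrE ?addr_ge0 ?enorm_ge0// sqrrD !sqr_enorm !dotvl.
have := normr_dotv_le v w; rewrite (dotvC w v) ler_norml => /andP[_].
by lra.
Qed.

Lemma enorm_dist v w : `|enorm v - enorm w| <= enorm (v - w).
Proof.
have := enormD (v - w) w; have := enormD (w - v) v.
by rewrite !subrK (enormB w) ler_norml; lra.
Qed.

Lemma enorm_sum (I : Type) (r : seq I) (P : pred I) (F : I -> 'cV[R]_d) :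
  enorm (\sum_(i <- r | P i) F i) <= \sum_(i <- r | P i) enorm (F i).
Proof.
elim/big_rec2: _ => [|i y x _ xy]; first by rewrite enorm0.
by rewrite (le_trans (enormD _ _))// lerD2l.
Qed.

Lemma normr_coord_le v i : `|v i 0| <= enorm v.
Proof.
rewrite -ler_sqr ?nnegrE ?enorm_ge0// sqr_enorm real_normK ?num_real//.
rewrite dotvE (bigD1 i)//= expr2 lerDl sumr_ge0// => j _.
by rewrite -expr2 sqr_ge0.
Qed.

Lemma colv_sum_delta v : v = \sum_i v i 0 *: delta_mx i 0.
Proof.
rewrite {1}[v]matrix_sum_delta; apply: eq_bigr => i _.
by rewrite big_ord1.
Qed.

Lemma enorm_delta i : enorm (delta_mx i 0 : 'cV[R]_d) = 1.
Proof.
rewrite /enorm dotvE (bigD1 i)//= big1 => [|k ki]; last by rewrite !mxE (negPf ki) mulr0.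
by rewrite !mxE !eqxx mulr1 addr0 sqrtr1.
Qed.

Lemma enorm_le_coord v (a : R) : (forall i, `|v i 0| <= a) -> enorm v <= d%:R * a.
Proof.
move=> va; rewrite [v in enorm v]colv_sum_delta (le_trans (enorm_sum _ _ _))//.
rewrite -[d in d%:R]card_ord mulr_natl -sumr_const ler_sum// => i _.
by rewrite enormZ enorm_delta mulr1.
Qed.

Definition area v w : R := Num.sqrt (areasq v w).

Lemma area_ge0 v w : 0 <= area v w. Proof. exact: sqrtr_ge0. Qed.

Lemma sqr_area v w : area v w ^+ 2 = areasq v w.
Proof. by rewrite sqr_sqrtr// areasq_ge0. Qed.

Lemma areaC v w : area v w = area w v.
Proof. by rewrite /area /areasq (dotvC w v) (mulrC (dotv v v)). Qed.

Lemma area0v w : area 0 w = 0.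
Proof. by rewrite /area /areasq !dot0v expr0n/= mul0r subrr sqrtr0. Qed.

Lemma area_le v w : area v w <= enorm v * enorm w.
Proof.
rewrite -ler_sqr ?nnegrE ?mulr_ge0 ?enorm_ge0 ?area_ge0// sqr_area exprMn !sqr_enorm.
by rewrite /areasq lerBlDr lerDl sqr_ge0.
Qed.

Lemma areaZl (a : R) v w : area (a *: v) w = `|a| * area v w.
Proof.
rewrite /area (_ : areasq _ _ = a ^+ 2 * areasq v w); last by rewrite /areasq !dotvl; ring.
by rewrite sqrtrM ?sqr_ge0// sqrtr_sqr.
Qed.

Lemma areaZr (a : R) v w : area v (a *: w) = `|a| * area v w.
Proof. by rewrite areaC areaZl areaC. Qed.

Lemma areaNl v w : area (- v) w = area v w.
Proof. by rewrite -scaleN1r areaZl normrN1 mul1r. Qed.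

Lemma areaNr v w : area v (- w) = area v w.
Proof. by rewrite areaC areaNl areaC. Qed.

(** Shearing preserves area.  This replaces the second of two almost parallel
chords by their difference, which is smaller by one order in the step size. *)
Lemma area_shear v w : area v (w - v) = area v w.
Proof. by rewrite /area; congr Num.sqrt; rewrite /areasq !dotvl (dotvC w v); ring. Qed.

Lemma area_perp v w :
  enorm v * area v w = enorm (dotv v v *: w - dotv v w *: v).
Proof. by rewrite /area /enorm -sqrtrM ?dotvv_ge0// areasq_perp. Qed.

(** For fixed [v], the area is a seminorm of [w]: it is [enorm v] times the length
of the component of [w] orthogonal to [v]. *)
Lemma areaD v w1 w2 : area v (w1 + w2) <= area v w1 + area v w2.
Proof.
have [->|v0] := eqVneq v 0; first by rewrite !area0v addr0.
rewrite -(ler_pM2l (x := enorm v)) ?enorm_gt0// mulrDr !area_perp.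
rewrite (le_trans _ (enormD _ _))//; apply: le_of_eq.
by congr enorm; rewrite dotvDr scalerDr scalerDl opprD addrACA.
Qed.

Lemma area_dist v w1 w2 : `|area v w1 - area v w2| <= enorm v * enorm (w1 - w2).
Proof.
have := area_le v (w1 - w2); have := areaD v (w1 - w2) w2.
have := areaD v (w2 - w1) w1; rewrite !subrK -(areaNr v (w2 - w1)) opprB ler_norml.
by lra.
Qed.

Lemma area_dist2 v1 v2 w1 w2 : `|area v1 w1 - area v2 w2| <=
  enorm v1 * enorm (w1 - w2) + enorm (v1 - v2) * enorm w2.
Proof.
rewrite -(subrKA (area v1 w2)) (le_trans (ler_normD _ _))// lerD// ?area_dist//.
by rewrite !(areaC _ w2) mulrC area_dist.
Qed.

End EuclideanGeometry.

(** * Principal angles and projections onto lines *)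

Section Angles.
Context {R : realType} {d : nat}.
Implicit Types u v w : 'cV[R]_d.

(** If [th] has cosine [c] and sine [s], the mean value theorem gives
[s = th * cos xi] with [xi] between [0] and [th], so [th * c <= s <= th]; and
[c >= c ^+ 2 = 1 - s ^+ 2]. *)
Lemma acos_sandwich (c s : R) : 0 <= c -> 0 <= s <= 2^-1 -> c ^+ 2 + s ^+ 2 = 1 ->
  s <= acos c <= s + s ^+ 2.
Proof.
move=> c0 /andP[s0 s2] cs.
have c1 : -1 <= c <= 1 by apply/andP; split; nra.
have th0 : 0 <= acos c by exact: acos_ge0.
have sE : sin (acos c) = s.
  rewrite sin_acos// (_ : 1 - c ^+ 2 = s ^+ 2); last by rewrite -cs; ring.
  by rewrite sqrtr_sqr ger0_norm.
have [xi /andP[xi0 xi1]] := @MVT_segment R sin cos 0 (acos c) th0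
  (fun x _ => is_derive_sin x) (continuous_subspaceT (@continuous_sin R)).
rewrite !bnd_simp in xi0 xi1.
rewrite sin0 !subr0 sE => sxi.
have : cos (acos c) <= cos xi.
  have [->//|xine] := eqVneq xi (acos c).
  apply: ltW; rewrite ltr_cos ?in_itv/= ?xi0 ?th0 ?acos_lepi//.
    by rewrite lt_neqAle xine.
  by rewrite (le_trans xi1)// acos_lepi.
rewrite acosK ?in_itv//= => cxi.
have cxi1 := cos_le1 xi.
have h1 : acos c * c <= s by rewrite sxi mulrC ler_wpM2r.
apply/andP; split; first by rewrite {1}sxi -[leRHS]mul1r ler_wpM2r.
have h2 : acos c * (1 - s ^+ 2) <= s.
  apply: le_trans h1; rewrite ler_wpM2l//; nra.
rewrite -(ler_pM2r (x := 1 - s ^+ 2)); last by nra.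
apply: (le_trans h2); rewrite -subr_ge0.
rewrite (_ : _ - _ = s ^+ 2 * (1 - s - s ^+ 2)); last by ring.
by rewrite mulr_ge0 ?sqr_ge0//; nra.
Qed.

(** The quotient [s] is the sine of the principal angle: the absolute value in the
cosine is harmless, because it affects neither the square of the cosine nor the
area.  Angles can thus be estimated through areas, which are Lipschitz in both
vectors, whereas [acos] is not Lipschitz near [1]. *)
Lemma vangle_sandwich v w : v != 0 -> w != 0 ->
  let s := area v w / (enorm v * enorm w) in
  s <= 2^-1 -> s <= vangle v w <= s + s ^+ 2.
Proof.
move=> v0 w0 s s2; have vw0 : 0 < enorm v * enorm w by rewrite mulr_gt0 ?enorm_gt0.
apply: acos_sandwich.
- by rewrite divr_ge0// ltW.
- by rewrite s2 divr_ge0 ?area_ge0// ltW.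
rewrite !exprMn exprVn -mulrDl sqr_area real_normK ?num_real//.
by rewrite /areasq subrKC exprMn !sqr_enorm mulfV// mulf_neq0// dotvv_eq0.
Qed.

Lemma orthoproj_line v u : v != 0 ->
  orthoproj <[v]>%VS u = (dotv v u / dotv v v) *: v.
Proof.
move=> v0; have [/vlineP[k ->] /orthocomplP/(_ _ (memv_line v))] := orthoprojP <[v]>%VS u.
rewrite !dotvl => /eqP; rewrite subr_eq0 => /eqP ->.
by rewrite mulfK// dotvv_eq0.
Qed.

(** The operator has rank at most one: it maps [u] to the multiple
[dotv v u / dotv v v] of the component of [A v] orthogonal to [v].  So the
supremum is attained at the unit vector along [v]. *)
Lemma opnorm_cross v (A : 'End('cV[R]_d)) : v != 0 ->
  let P := orthoproj <[v]>%VS in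
  opnorm ((\1 - P) \o A \o P)%VF = area v (A v) / dotv v v.
Proof.
move=> v0 P.
have vv0 : dotv v v != 0 by rewrite dotvv_eq0.
have vv0' : 0 < dotv v v by rewrite lt0r vv0 dotvv_ge0.
have nv0 : 0 < enorm v by rewrite enorm_gt0.
have LE u : enorm (((\1 - P) \o A \o P)%VF u) =
    `|dotv v u| / enorm v * (area v (A v) / dotv v v).
  rewrite !comp_lfunE /= !lfunE/= opp_lfunE id_lfunE /P !orthoproj_line//.
  rewrite linearZ/= dotvZr -mulrA -[in X in _ - X]scalerA -scalerBr enormZ.
  have -> : A v - (dotv v (A v) / dotv v v) *: v =
      (dotv v v)^-1 *: (dotv v v *: A v - dotv v (A v) *: v).
    by rewrite scalerBr !scalerA mulVf// scale1r (mulrC _^-1).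
  rewrite enormZ -area_perp normrM normfV (ger0_norm (ltW vv0')) -sqr_enorm.
  by rewrite !expr2; field; rewrite gt_eqF.
have c0 : 0 <= area v (A v) / dotv v v by rewrite divr_ge0 ?area_ge0// ltW.
have ub : ubound [set enorm (((\1 - P) \o A \o P)%VF u) | u in [set u | enorm u <= 1]]
    (area v (A v) / dotv v v).
  move=> _ [u /= u1 <-]; rewrite LE -[leRHS]mul1r ler_wpM2r// ler_pdivrMr// mul1r.
  by rewrite (le_trans (normr_dotv_le _ _))// -[leRHS]mulr1 ler_wpM2l// ltW.
apply/eqP; rewrite eq_le; apply/andP; split.
  by apply: ge_sup => //; exists (enorm (((\1 - P) \o A \o P)%VF 0)); exists 0; rewrite /= ?enorm0.
apply: ub_le_sup; first by exists (area v (A v) / dotv v v).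
exists ((enorm v)^-1 *: v) => /=.
  by rewrite enormZ ger0_norm ?invr_ge0 ?enorm_ge0// mulVf ?gt_eqF//.
rewrite LE dotvZr -sqr_enorm expr2 mulKf ?gt_eqF// ger0_norm ?enorm_ge0//.
by rewrite divff ?mul1r// gt_eqF.
Qed.

End Angles.

(** * Perturbation of the sine *)

Section Perturbation.
Context {R : realType} {d : nat}.
Implicit Types v w a b c e : 'cV[R]_d.

Lemma enorm_near v a (eps : R) : enorm (a - v) <= eps * enorm v ->
  (1 - eps) * enorm v <= enorm a <= (1 + eps) * enorm v.
Proof.
have := enorm_dist a v; rewrite ler_norml => /andP[h1 h2] h3.
by apply/andP; split; lra.
Qed.

(** All errors are relative to the length of [v], so that the bound does not
degenerate where the velocity of the curve tends to zero.  With [lam] small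
compared to [1] the error [eps] of the base vectors only enters through the product
[eps * lam]: base vectors of first order accuracy are enough for a second order
estimate of the sine. *)
Lemma sine_perturbation v a b c e (eps eta lam : R) : v != 0 ->
    0 <= eps <= 4^-1 ->
    enorm (a - v) <= eps * enorm v -> enorm (b - v) <= eps * enorm v ->
    enorm (c - e) <= eta * enorm v -> enorm e <= lam * enorm v ->
  `|area a c / (enorm a * enorm b) - area v e / dotv v v| <=
    3 * eta + 8 * eps * lam.
Proof.
move=> v0 /andP[e0 e4] av bv ce ev.
have := enorm_near av; have := enorm_near bv; have := area_dist2 a v c e.
have := area_le v e; rewrite -sqr_enorm.
have n0 : 0 < enorm v by rewrite enorm_gt0.
have := area_ge0 v e.
move: (enorm v) (enorm a) (enorm b) (area a c) (area v e) n0 av bv ce ev (enorm_ge0 (c - e))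
   (enorm_ge0 e) => n na nb al be n0 av bv ce ev ce0 eg0 be0 be1 albe /andP[b1 b2] /andP[a1 a2].
set N := na * nb.
(* The product [N] of the lengths is [n ^+ 2] up to the factor [1 + O(eps)]. *)
have n20 : 0 < n ^+ 2 by rewrite exprn_gt0.
have p0 : 0 <= (1 - eps) * n by rewrite mulr_ge0 ?(ltW n0)//; lra.
have Nlo : (1 - eps) ^+ 2 * n ^+ 2 <= N by rewrite -exprMn expr2 ler_pM.
have Nhi : N <= (1 + eps) ^+ 2 * n ^+ 2.
  by rewrite -exprMn expr2 ler_pM// (le_trans p0).
have N1 : 16^-1 * 9 * n ^+ 2 <= N.
  by apply: le_trans Nlo; rewrite ler_wpM2r ?(ltW n20)//; nra.
have N2 : `|n ^+ 2 - N| <= 3 * eps * n ^+ 2.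
  have elo : (1 - 3 * eps) * n ^+ 2 <= (1 - eps) ^+ 2 * n ^+ 2.
    by rewrite ler_wpM2r ?(ltW n20)//; nra.
  have ehi : (1 + eps) ^+ 2 * n ^+ 2 <= (1 + 3 * eps) * n ^+ 2.
    by rewrite ler_wpM2r ?(ltW n20)//; nra.
  by rewrite ler_norml; apply/andP; split; lra.
have ab1 : `|al - be| <= (5 / 4 * eta + eps * lam) * n ^+ 2.
  apply: (le_trans albe).
  have h1 : na * enorm (c - e) <= (5 / 4 * n) * (eta * n).
    have na0 : 0 <= na by exact: le_trans p0 a1.
    have na1 : na <= 5 / 4 * n by rewrite (le_trans a2)// ler_wpM2r ?(ltW n0)//; lra.
    exact: ler_pM.
  have h2 : enorm (a - v) * enorm e <= (eps * n) * (lam * n).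
    by apply: ler_pM => //; exact: enorm_ge0.
  by apply: le_trans (lerD h1 h2) _; apply: le_of_eq; ring.
have lam0 : 0 <= lam by rewrite -(pmulr_lge0 _ n0) (le_trans eg0).
have eta0 : 0 <= eta by rewrite -(pmulr_lge0 _ n0) (le_trans ce0).
have be2 : be <= lam * n ^+ 2.
  by apply: (le_trans be1); rewrite expr2 mulrCA ler_wpM2l// ltW.
have N0 : 0 < N by apply: lt_le_trans N1; rewrite mulr_gt0//; lra.
rewrite (_ : al / N - be / n ^+ 2 = ((al - be) + be / n ^+ 2 * (n ^+ 2 - N)) / N); last first.
  by field; rewrite !gt_eqF.
rewrite normrM normfV (gtr0_norm N0) ler_pdivrMr//.
apply: (le_trans (ler_normD _ _)); rewrite normrM.
have q0 : 0 <= be / n ^+ 2 by rewrite divr_ge0// ltW.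
have q1 : be / n ^+ 2 <= lam by rewrite ler_pdivrMr.
rewrite (ger0_norm q0).
have h3 : be / n ^+ 2 * `|n ^+ 2 - N| <= lam * (3 * eps * n ^+ 2) by apply: ler_pM.
apply: (le_trans (lerD ab1 h3)).
apply: (@le_trans _ _ ((3 * eta + 8 * eps * lam) * (16^-1 * 9 * n ^+ 2))).
  rewrite -subr_ge0.
  rewrite (_ : _ - _ = n ^+ 2 * (7 / 16 * eta + 1 / 2 * (eps * lam))); last by field.
  by rewrite mulr_ge0 ?(ltW n20)//; have := mulr_ge0 e0 lam0; lra.
by rewrite ler_wpM2l//; have := mulr_ge0 e0 lam0; lra.
Qed.

End Perturbation.

(** * Calculus on the half-line *)

Section HalfLineCalculus.
Context {R : realType}.
Implicit Types t s r a b : R.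

(** The derivative at [0] is replaced by right continuity, which is all that mean
value arguments on [[a, b]] with [0 <= a] use and which, unlike one-sided
differentiability, is immediate for compositions. *)
Definition primitive_ge0 {V : normedModType R} (u w : R -> V) : Prop :=
  u s @[s --> 0^'+] --> u 0 /\ forall t, 0 < t -> is_derive t 1 u (w t).

Lemma is_derive_ge0_interior {V : normedModType R} (u : R -> V) (t : R) (v : V) :
  0 < t -> is_derive_ge0 u t v -> is_derive t 1 u v.
Proof.
move=> t0 du.
have h : h^-1 *: (u (h + t) - u t) @[h --> 0^'] --> v.
  apply/cvgrPdist_lt => e e0.
  move/cvgrPdist_lt : du => /(_ e e0); rewrite near_withinE.
  move=> [r /= r0 rP]; exists (Num.min r t) => /=; first by rewrite lt_min r0.
  move=> s /=; rewrite sub0r normrN lt_min => /andP[sr st] s0.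
  have := rP (s + t); rewrite /quotient_ge0 /= addrK; apply.
  - by rewrite opprD addrCA subrr addr0 normrN.
  - by rewrite -subr_eq0 addrK.
  - by rewrite in_itv/= andbT; move: st; rewrite ltr_norml => /andP[]; lra.
apply: DeriveDef.
  apply/cvg_ex; exists v; apply: cvg_trans h; apply: near_eq_cvg; apply: nearW => s /=.
  by rewrite /= scaler1.
apply/cvg_lim => //; apply: cvg_trans h; apply: near_eq_cvg; apply: nearW => s /=.
by rewrite /= scaler1.
Qed.

Lemma within_ge0_dnbhs0 : within `[0, +oo[ (0 : R)^' = (0 : R)^'+.
Proof.
apply/funext => P; apply/propext; split=> -[r /= r0 rP]; exists r => //= s sr.
  by move=> s0; apply: rP => //; rewrite ?gt_eqF// in_itv/= ltW.
by move=> sn0; rewrite in_itv/= andbT => s0; apply: rP => //; rewrite lt0r sn0.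
Qed.

Lemma is_derive_ge0_primitive {V : normedModType R} (u w : R -> V) :
  (forall t, 0 <= t -> is_derive_ge0 u t (w t)) -> primitive_ge0 u w.
Proof.
move=> du; split => [|t t0]; last exact: is_derive_ge0_interior t0 (du _ (ltW t0)).
have h : s^-1 *: (u s - u 0) @[s --> 0^'+] --> w 0.
  have := du 0 (lexx 0); rewrite /is_derive_ge0 within_ge0_dnbhs0.
  by under eq_fun do rewrite /quotient_ge0 subr0.
have : (s *: (s^-1 *: (u s - u 0)) + u 0) @[s --> 0^'+] --> 0 *: w 0 + u 0.
  apply: cvgD; last exact: cvg_cst.
  by apply: cvgZ => //; apply: cvg_within.
rewrite scale0r add0r; apply: cvg_trans; apply: near_eq_cvg.
near=> s; rewrite scalerA mulfV ?scale1r ?subrK// gt_eqF//.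
Unshelve. all: by end_near. Qed.

Lemma derive_ge0_val {V : normedModType R} (u : R -> V) (v : V) :
  is_derive_ge0 u 0 v -> derive_ge0 u 0 = v.
Proof. by rewrite /is_derive_ge0 /derive_ge0 within_ge0_dnbhs0 => /cvg_lim ->. Qed.

Lemma primitive_within {V : normedModType R} (u w : R -> V) :
  primitive_ge0 u w -> {within `[0, +oo[, continuous u}.
Proof.
move=> [u0 du]; apply/continuous_within_itvcyP; split => // t.
rewrite in_itv/= andbT => t0; apply: differentiable_continuous.
by apply/derivable1_diffP; have [] := du _ t0.
Qed.

Lemma primitive_withinS {V : normedModType R} (u w : R -> V) (a b : R) :
  primitive_ge0 u w -> 0 <= a -> {within `[a, b], continuous u}.
Proof.
move=> /primitive_within cu a0; apply: continuous_subspaceW cu => t.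
by rewrite /= !in_itv/= andbT => /andP[at_ _]; exact: le_trans at_.
Qed.

End HalfLineCalculus.

(** * Mean value and Gronwall inequalities for the Euclidean norm *)

Section EuclideanCalculus.
Context {R : realType} {d : nat}.
Implicit Types (t s r a b M : R) (u v w x : R -> 'cV[R]_d).

Lemma is_derive_coord u t (l : 'cV[R]_d) i :
  is_derive t 1 u l -> is_derive t 1 (fun s => u s i 0) (l i 0).
Proof.
move=> [du <-]; apply: DeriveDef; first exact: (derivable_mxP _ _ _).1.
by rewrite derive_mx// mxE.
Qed.

Lemma cvg_dotv {T : Type} {F : set_system T} {FF : Filter F} (u v : T -> 'cV[R]_d)
    (l m : 'cV[R]_d) :
  u z @[z --> F] --> l -> v z @[z --> F] --> m ->
  dotv (u z) (v z) @[z --> F] --> dotv l m.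
Proof.
move=> ul vm; under eq_fun do rewrite dotvE; rewrite dotvE.
apply: cvg_big => [|i _]; first exact: add_continuous.
apply: cvgM.
  exact: (cvg_comp _ (fun M : 'cV[R]_d => M i 0) ul (@coord_continuous _ _ _ i 0 l)).
exact: (cvg_comp _ (fun M : 'cV[R]_d => M i 0) vm (@coord_continuous _ _ _ i 0 m)).
Qed.

Lemma primitive_cst (c : 'cV[R]_d) : primitive_ge0 (fun _ : R => c) (fun _ => 0).
Proof. by split=> [|t _]; [exact: cvg_cst|exact: is_derive_cst]. Qed.

Lemma primitive_dotv u u' v v' : primitive_ge0 u u' -> primitive_ge0 v v' ->
  primitive_ge0 (fun t => dotv (u t) (v t))
    (fun t => dotv (u' t) (v t) + dotv (u t) (v' t)).
Proof.
move=> [u0 du] [v0 dv]; split => [|t t0]; first exact: cvg_dotv.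
have h i : is_derive t 1 ((fun s => u s i 0) * (fun s => v s i 0))
    (u t i 0 *: v' t i 0 + v t i 0 *: u' t i 0).
  have := is_derive_coord i (du _ t0); have := is_derive_coord i (dv _ t0) => ? ?.
  exact: is_deriveM.
have := is_derive_sum h.
rewrite (_ : \sum_i (fun s => u s i 0) * _ = fun s => dotv (u s) (v s)); last first.
  by apply/funext => s; rewrite fct_sumE dotvE; apply: eq_bigr.
rewrite (_ : \sum_i _ = dotv (u' t) (v t) + dotv (u t) (v' t))//.
rewrite !dotvE -big_split/=; apply: eq_bigr => i _.
by rewrite addrC /GRing.scale/= (mulrC (v t i 0)).
Qed.

Lemma primitive_dotl (e : 'cV[R]_d) u w : primitive_ge0 u w ->
  primitive_ge0 (fun t => dotv e (u t)) (fun t => dotv e (w t)).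
Proof.
move=> uw; have [h1 h2] := primitive_dotv (primitive_cst e) uw; split => // t t0.
by have := h2 _ t0; rewrite dot0v add0r.
Qed.

(** The scalar mean value theorem is applied to the component along the very vector
[e] that is to be bounded.  Subtracting a line with slope [p] and a parabola with
second derivative [q] lets repeated use produce Taylor estimates: a bound on the
expansion of the derivative becomes a bound on the expansion of [u]. *)
Lemma mean_value_enorm u w a b (c M : R) (p q : 'cV[R]_d) :
  primitive_ge0 u w -> 0 <= a -> a <= b ->
  (forall r, a <= r <= b -> enorm (w r - p - (r - c) *: q) <= M) ->
  enorm (u b - u a - (b - a) *: p - (((b - c) ^+ 2 - (a - c) ^+ 2) / 2) *: q)
    <= M * (b - a).
Proof.
move=> uw a0 ab wM; set e : 'cV[R]_d := (X in enorm X).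
have ew := primitive_dotl e uw.
pose g : R -> R := (fun r => dotv e (u r)) - dotv e p *: id - (dotv e q / 2) *: (id - cst c) ^+ 2.
have gE r : g r = dotv e (u r) - dotv e p * r - dotv e q / 2 * (r - c) ^+ 2.
  by rewrite /g !fctE /= /GRing.scale /=.
have gc : {within `[a, b], continuous g}.
  have cpoly : continuous (dotv e p *: id + (dotv e q / 2) *: (id - cst c) ^+ 2 : R -> R).
    by move=> z; apply/differentiable_continuous/derivable1_diffP/ex_derive.
  have -> : g = (fun r => dotv e (u r)) -
      (dotv e p *: id + (dotv e q / 2) *: (id - cst c) ^+ 2).
    by apply/funext => z; rewrite gE !fctE/= /GRing.scale/= opprD addrA.
  move=> z; apply: continuousD _; first exact: (primitive_withinS ew a0).
  exact/continuousN/continuous_subspaceT.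
pose g' r := dotv e (w r) - dotv e p - dotv e q * (r - c).
have [r rab gba] : exists2 r, r \in `[a, b] & g b - g a = g' r * (b - a).
  apply: MVT_segment => // r.
    rewrite in_itv/= => /andP[ar rb]; have [_ /(_ r (le_lt_trans a0 ar)) dr] := ew.
    rewrite /g; apply: is_derive_eq.
    rewrite /g' !fctE /= /GRing.scale /=; by field.
have : dotv e e = g b - g a.
  rewrite !gE -[X in dotv _ X]/(u b - u a - (b - a) *: p -
    (((b - c) ^+ 2 - (a - c) ^+ 2) / 2) *: q) !dotvl; by field.
rewrite -sqr_enorm gba (_ : g' r = dotv e (w r - p - (r - c) *: q)); last first.
  by rewrite /g' !(dotvDr, dotvNr, dotvZr) (mulrC (dotv e q)).
move=> ee; have [->|e0] := eqVneq (enorm e) 0.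
  rewrite mulr_ge0 ?subr_ge0//; apply: le_trans (enorm_ge0 _) (wM r _).
  by move: rab; rewrite in_itv.
have e0' : 0 < enorm e by rewrite lt0r e0 enorm_ge0.
rewrite -(ler_pM2l e0') -expr2 ee mulrA ler_wpM2r ?subr_ge0//.
rewrite (le_trans (ler_norm _))// (le_trans (normr_dotv_le _ _))// ler_wpM2l ?enorm_ge0//.
by apply: wM; move: rab; rewrite in_itv.
Qed.

Lemma mean_value_enorm_sym u w t s (M : R) (p q : 'cV[R]_d) :
  primitive_ge0 u w -> 0 <= t -> 0 <= s ->
  (forall r, 0 <= r -> `|r - t| <= `|s - t| -> enorm (w r - p - (r - t) *: q) <= M) ->
  enorm (u s - u t - (s - t) *: p - ((s - t) ^+ 2 / 2) *: q) <= M * `|s - t|.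
Proof.
move=> uw t0 s0 wM; have [ts|st] := leP t s.
  have := @mean_value_enorm u w t s t M p q uw t0 ts.
  rewrite subrr expr0n/= subr0 (ger0_norm (_ : 0 <= s - t)) ?subr_ge0//; apply => r /andP[tr rs].
  by apply: wM; [exact: le_trans tr|rewrite !ger0_norm ?subr_ge0// lerD2r].
rewrite (_ : u s - u t - _ - _ = - (u t - u s - (t - s) *: p -
    (((t - t) ^+ 2 - (s - t) ^+ 2) / 2) *: q)); last first.
  by apply/matrixP => i j; rewrite !mxE; field.
rewrite enormN distrC (ger0_norm (_ : 0 <= t - s)) ?subr_ge0 ?(ltW st)//.
apply: (mean_value_enorm uw _ (ltW st)) => // r /andP[sr rt]; apply: wM; first exact: le_trans sr.
by rewrite !ler0_norm ?subr_le0 ?(ltW st)// lerN2 lerD2r.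
Qed.

Lemma primitive_homo (g g' : R -> R) (a b : R) : primitive_ge0 g g' -> 0 <= a -> a <= b ->
  (forall r, 0 <= r -> 0 <= g' r) -> g a <= g b.
Proof.
move=> gg a0 ab g0; rewrite -subr_ge0.
have [r|r] := @MVT_segment _ g g' a b ab _ (primitive_withinS gg a0).
  by rewrite in_itv/= => /andP[ar rb]; exact: gg.2 _ (le_lt_trans a0 ar).
rewrite in_itv/= => /andP[ar rb] ->.
by rewrite mulr_ge0 ?subr_ge0// g0// (le_trans a0).
Qed.

(** The inequality holds forward and backward in time: the squared norm multiplied
by [expR (- 2 * L * t)] decreases and multiplied by [expR (2 * L * t)] increases.
The backward direction shows that a solution that vanishes once vanishes always. *)
Lemma gronwall v w L a b : primitive_ge0 v w ->
  (forall t, 0 <= t -> enorm (w t) <= L * enorm (v t)) -> 0 <= a -> 0 <= b ->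
  enorm (v b) ^+ 2 <= expR (2 * L * `|b - a|) * enorm (v a) ^+ 2.
Proof.
move=> vw' wL a0 b0.
have vw r : 0 <= r -> `|dotv (v r) (w r)| <= L * dotv (v r) (v r).
  move=> r0; rewrite (le_trans (normr_dotv_le _ _))//.
  by rewrite -sqr_enorm expr2 mulrCA ler_wpM2l ?enorm_ge0// wL.
(* [sg] is a sign, so that one monotonicity argument serves both directions. *)
have key (sg m : R) : (forall r, 0 <= r ->
      0 <= sg * (m * dotv (v r) (v r) + 2 * dotv (v r) (w r))) ->
    forall s t, 0 <= s -> s <= t ->
    sg * expR (m * s) * dotv (v s) (v s) <= sg * expR (m * t) * dotv (v t) (v t).
  move=> mw s t s0 st.
  pose g r := sg * expR (m * r) * dotv (v r) (v r).
  pose g' r := expR (m * r) * (sg * (m * dotv (v r) (v r) + 2 * dotv (v r) (w r))).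
  apply: (@primitive_homo g g') => // [|r r0]; last by rewrite mulr_ge0 ?expR_ge0 ?mw.
  have [vv0 dvv] := primitive_dotv vw' vw'.
  split => [|r r0].
    apply: cvgM => //; apply: cvgM; first exact: cvg_cst.
    apply: (cvg_comp (fun s => m * s) expR); last exact: continuous_expR.
    by apply: cvgM; [exact: cvg_cst|apply: cvg_within].
  have dvvr := dvv _ r0.
  have dm : is_derive r 1 (fun r => m * r) m.
    have -> : (fun r => m * r) = m *: id by apply/funext.
    by apply: is_derive_eq; rewrite /GRing.scale/= mulr1.
  have de : is_derive r 1 (fun r => expR (m * r)) (expR (m * r) * m).
    exact: (@is_derive1_comp _ expR (fun r => m * r)).
  have -> : g = (sg *: (fun r => expR (m * r))) * (fun r => dotv (v r) (v r)) by apply/funext.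
  by apply: is_derive_eq; rewrite /g' !fctE/= /GRing.scale/= (dotvC (w r)); ring.
have [ab|ba] := leP a b.
  have := key (-1) (- (2 * L)) _ a b a0 ab.
  rewrite ger0_norm ?subr_ge0// !mulN1r !mulNr lerN2 !expRN => h.
  have {}h : dotv (v b) (v b) / expR (2 * L * b) <= dotv (v a) (v a) / expR (2 * L * a).
    rewrite mulrC [leRHS]mulrC; apply: h => r r0.
    by have := vw r r0; rewrite ler_norml => /andP[]; lra.
  move: h; rewrite ler_pdivrMr ?expR_gt0// => h.
  by rewrite !sqr_enorm (le_trans h)// mulrBr expRB; lra.
have := key 1 (2 * L) _ b a b0 (ltW ba).
rewrite ltr0_norm ?subr_lt0// opprB !mul1r => h.
have {}h : expR (2 * L * b) * dotv (v b) (v b) <= expR (2 * L * a) * dotv (v a) (v a).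
  apply: h => r r0.
  by have := vw r r0; rewrite ler_norml => /andP[]; lra.
rewrite !sqr_enorm mulrBr expRB -(ler_pM2l (expR_gt0 (2 * L * b))).
rewrite (le_trans h)// [leRHS]mulrA (mulrC (expR _) (_ / _)) divfK ?gt_eqF ?expR_gt0//.
Qed.

End EuclideanCalculus.

(** * Riemann sums of locally Lipschitz functions *)

Section RiemannSum.
Context {R : realType}.
Variables (g : R -> R) (C h : R).
Implicit Types s t a b T : R.
Hypothesis C_ge0 : 0 <= C.
Hypothesis h_gt0 : 0 < h.
Hypothesis g_lip : forall s t, 0 <= s -> 0 <= t -> `|s - t| <= h ->
  `|g s - g t| <= C * `|s - t|.

Local Notation mu := (@lebesgue_measure R).

Lemma loc_lip_integrable T : mu.-integrable `[0, T] (EFin \o g).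
Proof.
apply: continuous_compact_integrable; first exact: segment_compact.
apply/subspace_continuousP => t; rewrite /= in_itv/= => /andP[t0 tT].
apply/cvgrPdist_le => e e0; rewrite near_withinE.
near=> s => s0T.
have s0 : 0 <= s by move: s0T; rewrite /= in_itv/= => /andP[].
have ts : `|t - s| <= Num.min h (e / (C + 1)).
  near: s; exists (Num.min h (e / (C + 1))) => /=; last by move=> s /= /ltW.
  by rewrite lt_min h_gt0 divr_gt0// ltr_wpDl.
move: ts; rewrite le_min => /andP[th te].
rewrite (le_trans (g_lip t0 s0 th))//.
move: te; rewrite ler_pdivlMr ?ltr_wpDl// => te.
by apply: le_trans te; rewrite mulrC ler_wpM2l// lerDl.
Unshelve. all: by end_near. Qed.

Lemma integral_cell a : 0 <= a ->
  `|\int[mu]_(t in `]a, a + h]) g t - h * g (a + h)| <= C * h ^+ 2.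
Proof.
move=> a0; set D := [set` `]a, a + h]].
have mD : measurable D by exact: measurable_itv.
have ah : a <= a + h by rewrite lerDl ltW.
have ig : mu.-integrable D (EFin \o g).
  apply: integrableS (loc_lip_integrable (a + h)) => //.
  by move=> t; rewrite /D /= !in_itv/= => /andP[/ltW/(le_trans a0) -> ->].
have muD : fine (mu D) = h.
  rewrite /D lebesgue_measure_itv/= lte_fin ltrDl h_gt0 -EFinD/=; ring.
have ic (c : R) : mu.-integrable D (EFin \o cst c).
  have icc : mu.-integrable `[a, a + h] (EFin \o cst c).
    apply: continuous_compact_integrable; first exact: segment_compact.
    by apply: continuous_subspaceT => ?; exact: cvg_cst.
  by apply: integrableS icc => //; exact: subset_itv_oc_cc.
have Ic (c : R) : \int[mu]_(t in D) c = c * h by rewrite Rintegral_cst// muD.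
have gD t : D t -> `|g t - g (a + h)| <= C * h.
  rewrite /D /= in_itv/= => /andP[at_ tah].
  have tah' : `|t - (a + h)| <= h by rewrite ler_norml; apply/andP; split; lra.
  by rewrite (le_trans (g_lip _ _ tah'))// ?ler_wpM2l//; lra.
have lo : (g (a + h) - C * h) * h <= \int[mu]_(t in D) g t.
  rewrite -Ic; apply: le_Rintegral => // [|t /gD]; first exact: ic.
  by rewrite ler_norml => /andP[]; lra.
have hi : \int[mu]_(t in D) g t <= (g (a + h) + C * h) * h.
  rewrite -Ic; apply: le_Rintegral => // [|t /gD]; first exact: ic.
  by rewrite ler_norml => /andP[]; lra.
move: (\int[mu]_(t in D) g t) lo hi => I lo hi; clear -lo hi.
by rewrite ler_norml; apply/andP; split; lra.
Qed.

Lemma right_riemann_sum_error N :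
  `|\int[mu]_(t in `[0, N%:R * h]) g t - \sum_(1 <= j < N.+1) h * g (j%:R * h)|
    <= N%:R * (C * h ^+ 2).
Proof.
elim: N => [|N IH].
  by rewrite !mul0r set_itv1 Rintegral_set1 big_geq// subrr normr0.
have Nh0 : 0 <= N%:R * h by rewrite mulr_ge0// ltW.
have NE : N.+1%:R * h = N%:R * h + h by rewrite -natr1 mulrDl mul1r.
have ch := integral_cell Nh0.
have := @Rintegral_itvB R g (BLeft 0) (BRight (N%:R * h + h)) (N%:R * h)
  (loc_lip_integrable _).
rewrite !bnd_simp lerDl (ltW h_gt0) => /(_ Nh0 isT) split_int.
rewrite big_nat_recr//= NE.
rewrite (_ : _ - _ = (\int[mu]_(t in `[0, N%:R * h]) g t -
  \sum_(1 <= j < N.+1) h * g (j%:R * h)) +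
  (\int[mu]_(t in `]N%:R * h, N%:R * h + h]) g t - h * g (N%:R * h + h))); last first.
  by rewrite -split_int; ring.
by rewrite -natr1 mulrDl mul1r (le_trans (ler_normD _ _))// lerD.
Qed.

End RiemannSum.

(** * Curves whose acceleration is controlled by their velocity *)

Section CurveEstimates.
Context {R : realType} {d : nat}.
Variables (x v w : R -> 'cV[R]_d) (L K : R).
Implicit Types t s r h : R.
Hypothesis L_gt0 : 0 < L.
Hypothesis K_ge0 : 0 <= K.
Hypothesis xv : primitive_ge0 x v.
Hypothesis vw : primitive_ge0 v w.
Hypothesis v_neq0 : forall t, 0 <= t -> v t != 0.
Hypothesis w_le : forall t, 0 <= t -> enorm (w t) <= L * enorm (v t).
(* For [w = A v] with [A] bounded by [L] and [K]-Lipschitz in time, this splits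
[w s - w t] at [A t (v s)]. *)
Hypothesis w_dist : forall s t, 0 <= s -> 0 <= t ->
  enorm (w s - w t) <= K * `|s - t| * enorm (v s) + L * enorm (v s - v t).

(** The Lipschitz constant of the acceleration relative to the velocity. *)
Let K' := 2 * K + 2 * L ^+ 2.

Let K'_ge0 : 0 <= K'.
Proof. by rewrite /K'; have := sqr_ge0 L; have := K_ge0; lra. Qed.

(** On time scales below [1 / (4 * L)] the velocity changes at most by a factor of
two, so estimates relative to [enorm (v t)] hold uniformly along the curve. *)
Lemma velocity_le2 s t : 0 <= s -> 0 <= t -> 4 * L * `|s - t| <= 1 ->
  enorm (v s) <= 2 * enorm (v t).
Proof.
move=> s0 t0 st.
have h := gronwall vw w_le t0 s0.
rewrite -ler_sqr ?nnegrE ?mulr_ge0 ?enorm_ge0// exprMn (le_trans h)// ler_wpM2r ?sqr_ge0//.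
have := expR_ge1Dx (- (2 * L * `|s - t|)); rewrite expRN => h2.
have : 2^-1 <= (expR (2 * L * `|s - t|))^-1 by apply: le_trans h2; lra.
rewrite lef_pV2 ?posrE ?expR_gt0// => /le_trans; apply; lra.
Qed.

Lemma between_small s t r : `|r - t| <= `|s - t| -> 4 * L * `|s - t| <= 1 ->
  4 * L * `|r - t| <= 1.
Proof. by move=> rs; apply: le_trans; rewrite ler_wpM2l// mulr_ge0// ltW. Qed.

Lemma velocity_lip s t : 0 <= s -> 0 <= t -> 4 * L * `|s - t| <= 1 ->
  enorm (v s - v t) <= 2 * L * `|s - t| * enorm (v t).
Proof.
move=> s0 t0 st.
have := @mean_value_enorm_sym _ _ v w t s (2 * L * enorm (v t)) 0 0 vw t0 s0.
rewrite !scaler0 !subr0.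
rewrite (_ : _ * enorm _ * _ = 2 * L * `|s - t| * enorm (v t)); last by ring.
apply => r r0 rs.
rewrite scaler0 !subr0 (le_trans (w_le r0))// (mulrC 2) -mulrA ler_wpM2l ?(ltW L_gt0)//.
by apply: velocity_le2 => //; exact: between_small st.
Qed.

Lemma acceleration_lip s t : 0 <= s -> 0 <= t -> 4 * L * `|s - t| <= 1 ->
  enorm (w s - w t) <= K' * `|s - t| * enorm (v t).
Proof.
move=> s0 t0 st; apply: (le_trans (w_dist s0 t0)).
apply: (@le_trans _ _ (K * `|s - t| * (2 * enorm (v t)) + L * (2 * L * `|s - t| * enorm (v t)))).
  apply: lerD; first by rewrite ler_wpM2l ?mulr_ge0// velocity_le2.
  by rewrite ler_wpM2l ?(ltW L_gt0)// velocity_lip.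
by apply: le_of_eq; rewrite /K'; ring.
Qed.

Lemma velocity_taylor s t : 0 <= s -> 0 <= t -> 4 * L * `|s - t| <= 1 ->
  enorm (v s - v t - (s - t) *: w t) <= K' * `|s - t| ^+ 2 * enorm (v t).
Proof.
move=> s0 t0 st.
have := @mean_value_enorm_sym _ _ v w t s (K' * `|s - t| * enorm (v t)) (w t) 0 vw t0 s0.
rewrite scaler0 subr0 (_ : _ * _ * enorm _ * _ = K' * `|s - t| ^+ 2 * enorm (v t)); last by ring.
apply => r r0 rs; rewrite scaler0 subr0.
apply: (le_trans (acceleration_lip r0 t0 (between_small rs st))).
by rewrite ler_wpM2r ?enorm_ge0// ler_wpM2l.
Qed.

Lemma position_taylor1 s t : 0 <= s -> 0 <= t -> 4 * L * `|s - t| <= 1 ->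
  enorm (x s - x t - (s - t) *: v t) <= 2 * L * `|s - t| ^+ 2 * enorm (v t).
Proof.
move=> s0 t0 st.
have := @mean_value_enorm_sym _ _ x v t s (2 * L * `|s - t| * enorm (v t)) (v t) 0 xv t0 s0.
rewrite scaler0 subr0 (_ : _ * enorm _ * _ = 2 * L * `|s - t| ^+ 2 * enorm (v t)); last by ring.
apply => r r0 rs; rewrite scaler0 subr0.
apply: (le_trans (velocity_lip r0 t0 (between_small rs st))).
by rewrite ler_wpM2r ?enorm_ge0// ler_wpM2l// mulr_ge0// ltW.
Qed.

Lemma position_taylor2 s t : 0 <= s -> 0 <= t -> 4 * L * `|s - t| <= 1 ->
  enorm (x s - x t - (s - t) *: v t - ((s - t) ^+ 2 / 2) *: w t)
    <= K' * `|s - t| ^+ 3 * enorm (v t).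
Proof.
move=> s0 t0 st.
have := @mean_value_enorm_sym _ _ x v t s (K' * `|s - t| ^+ 2 * enorm (v t)) (v t) (w t) xv t0 s0.
rewrite (_ : _ * enorm _ * _ = K' * `|s - t| ^+ 3 * enorm (v t)); last by ring.
apply => r r0 rs.
apply: (le_trans (velocity_taylor r0 t0 (between_small rs st))).
by rewrite ler_wpM2r ?enorm_ge0// ler_wpM2l// ler_sqr ?nnegrE.
Qed.

(** The norm of the derivative of the unit vector [(enorm v)^-1 *: v] when [w] is the
derivative of [v]. *)
Definition turning_rate t : R := area (v t) (w t) / dotv (v t) (v t).

Lemma turning_rate_ge0 t : 0 <= turning_rate t.
Proof. by rewrite divr_ge0 ?area_ge0 ?dotvv_ge0. Qed.

Lemma turning_rate_le t : 0 <= t -> turning_rate t <= L.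
Proof.
move=> t0; have v0 : 0 < enorm (v t) by rewrite enorm_gt0 v_neq0.
rewrite /turning_rate -sqr_enorm ler_pdivrMr ?exprn_gt0//.
rewrite (le_trans (area_le _ _))// expr2 mulrCA ler_wpM2l ?(ltW v0)// w_le//.
Qed.

(** From the perturbation of the sine with [eps = 2 * L * r], [eta = K' * r] and
[lam = L], where [r] is the time difference. *)
Let Crate := 3 * K' + 16 * L ^+ 2.

(** A degenerate case of the perturbation of the sine: both base vectors are
[v s], so that the sine becomes the turning rate itself. *)
Lemma turning_rate_lip s t : 0 <= s -> 0 <= t -> 8 * L * `|s - t| <= 1 ->
  `|turning_rate s - turning_rate t| <= Crate * `|s - t|.
Proof.
move=> s0 t0 st.
have st0 : 0 <= L * `|s - t| by rewrite mulr_ge0// ltW.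
have st4 : 4 * L * `|s - t| <= 1 by lra.
rewrite {1}/turning_rate -sqr_enorm expr2.
have := @sine_perturbation _ _ (v t) (v s) (v s) (w s) (w t)
  (2 * L * `|s - t|) (K' * `|s - t|) L.
have vl := velocity_lip s0 t0 st4.
move=> /(_ (v_neq0 t0) _ vl vl (acceleration_lip s0 t0 st4) (w_le t0)) h.
apply: (le_trans (h _)); first by apply/andP; split; lra.
by apply: le_of_eq; rewrite /Crate; ring.
Qed.

(** From the perturbation of the sine with [eps = 2 * L * h], [eta = 2 * K' * h ^+ 2]
and [lam = L * h]. *)
Let Cangle := 6 * K' + 16 * L ^+ 2.

(** Both chords [a] and [b] are [h *: v t] up to a relative error [O(h)], and their
difference is [h ^+ 2 *: w t] up to [O(h ^+ 3)]: the first order terms cancel by the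
symmetry of the three sampling times about [t].  The sine of the angle is the area
spanned by [a] and [b - a] divided by the lengths, hence [h * turning_rate t] up to
[O(h ^+ 2)], and the angle differs from its sine by another [O(h ^+ 2)]. *)
Lemma chord_angle t h : 0 < h -> h <= t -> 8 * L * h <= 1 -> 4 * h <= 1 -> Cangle * h <= 1 ->
  `|vangle (x (t - h) - x t) (x t - x (t + h)) - h * turning_rate t|
    <= (Cangle + (L + 1) ^+ 2) * h ^+ 2.
Proof.
move=> h0 ht h8 h4 hC.
have h0' := ltW h0.
have t0 : 0 <= t by exact: le_trans ht.
have tm0 : 0 <= t - h by rewrite subr_ge0.
have tp0 : 0 <= t + h by rewrite addr_ge0.
have em : t - h - t = - h by ring.
have ep : t + h - t = h by ring.
have Lh0 : 0 <= L * h by rewrite mulr_ge0// ltW.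
have sm : 4 * L * `|t - h - t| <= 1 by rewrite em normrN gtr0_norm//; lra.
have sp : 4 * L * `|t + h - t| <= 1 by rewrite ep gtr0_norm//; lra.
pose a := x t - x (t - h); pose b := x (t + h) - x t.
have v0 := v_neq0 t0.
have hv0 : h *: v t != 0 by rewrite scaler_eq0 negb_or gt_eqF.
have nhv : enorm (h *: v t) = h * enorm (v t) by rewrite enormZ gtr0_norm.
have av : enorm (a - h *: v t) <= 2 * L * h * enorm (h *: v t).
  have := position_taylor1 tm0 t0 sm; rewrite em normrN gtr0_norm// nhv.
  rewrite enormB (_ : - h *: v t - _ = a - h *: v t); last first.
    by rewrite /a opprB scaleNr addrC.
  by move/le_trans; apply; apply: le_of_eq; ring.
have bv : enorm (b - h *: v t) <= 2 * L * h * enorm (h *: v t).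
  have := position_taylor1 tp0 t0 sp; rewrite ep gtr0_norm// nhv.
  by move/le_trans; apply; apply: le_of_eq; ring.
have ce : enorm ((b - a) - h ^+ 2 *: w t) <= 2 * K' * h ^+ 2 * enorm (h *: v t).
  have := position_taylor2 tp0 t0 sp; rewrite ep gtr0_norm//.
  have := position_taylor2 tm0 t0 sm; rewrite em normrN gtr0_norm// => hm hp.
  rewrite nhv; have := lerD hm hp; rewrite -mulrDl -mulr2n => {hm hp}.
  move=> hmp; apply: le_trans (le_trans _ hmp) _; last first.
    by apply: le_of_eq; ring.
  apply: le_trans (enormD _ _).
  apply: le_of_eq; congr enorm.
  by apply/matrixP => i j; rewrite /a /b !mxE; field.
have ev : enorm (h ^+ 2 *: w t) <= L * h * enorm (h *: v t).
  rewrite nhv enormZ ger0_norm ?sqr_ge0//.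
  rewrite (_ : L * h * _ = h ^+ 2 * (L * enorm (v t))); last by ring.
  by rewrite ler_wpM2l ?sqr_ge0// w_le.
have e1 : 0 <= 2 * L * h <= 4^-1 by apply/andP; split; lra.
have := sine_perturbation hv0 e1 av bv ce ev.
have an0 : a != 0.
  rewrite -enorm_gt0; have /andP[+ _] := enorm_near av; apply: lt_le_trans.
  by rewrite mulr_gt0 ?enorm_gt0//; lra.
have bn0 : b != 0.
  rewrite -enorm_gt0; have /andP[+ _] := enorm_near bv; apply: lt_le_trans.
  by rewrite mulr_gt0 ?enorm_gt0//; lra.
rewrite area_shear areaZl areaZr dotvZl dotvZr (gtr0_norm h0) (ger0_norm (sqr_ge0 _)).
have vv0 : dotv (v t) (v t) != 0 by rewrite dotvv_eq0.
rewrite (_ : h * (h ^+ 2 * _) / _ = h * turning_rate t); last first.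
  by rewrite /turning_rate; field; rewrite vv0 gt_eqF.
have -> : 3 * (2 * K' * h ^+ 2) + 8 * (2 * L * h) * (L * h) = Cangle * h ^+ 2.
  by rewrite /Cangle; ring.
have -> : vangle (x (t - h) - x t) (x t - x (t + h)) = vangle a b.
  rewrite (_ : x (t - h) - x t = - a); last by rewrite /a opprB.
  rewrite (_ : x t - x (t + h) = - b); last by rewrite /b opprB.
  by rewrite /vangle !enormN dotvNl dotvNr opprK.
have := vangle_sandwich an0 bn0; set s := area a b / _.
have s0 : 0 <= s by rewrite divr_ge0 ?area_ge0 ?mulr_ge0 ?enorm_ge0.
have r0 := turning_rate_ge0 t; have rL := turning_rate_le t0.
set rho := turning_rate t in r0 rL *; clearbody s rho.
have C10 : 0 <= Cangle by rewrite /Cangle; have := sqr_ge0 L; have := K'_ge0; lra.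
move: (vangle a b) => th sand srho.
have hrL : h * rho <= L * h by rewrite mulrC ler_wpM2r.
have Ch2 : Cangle * h ^+ 2 <= h by rewrite expr2 mulrA -[leRHS]mul1r ler_wpM2r.
have sle : s <= (L + 1) * h by move: srho; rewrite ler_norml => /andP[]; lra.
have s2 : s <= 2^-1 by lra.
have ss : s ^+ 2 <= (L + 1) ^+ 2 * h ^+ 2.
  by rewrite -exprMn ler_sqr ?nnegrE// mulr_ge0//; have := L_gt0; lra.
have /andP[th1 th2] := sand s2.
move: srho; rewrite !ler_norml => /andP[q1 q2].
have L12 : 0 <= (L + 1) ^+ 2 * h ^+ 2 by rewrite mulr_ge0 ?sqr_ge0.
by apply/andP; split; lra.
Qed.

(** Each of the [N] steps contributes an error [O(h ^+ 2)] to the sum of angles and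
to the Riemann sum, and [N * h ^+ 2 = T * h]. *)
Lemma mean_turning_rate_discretization :
  exists C h0 : R, [/\ 0 < C, 0 < h0 &
    forall T N, 0 < T -> (0 < N)%N -> let h := T / N%:R in h <= h0 ->
      `|T^-1 * \int[lebesgue_measure]_(t in `[0, T]) turning_rate t -
        alpha1_diff x h T N| <= C * h].
Proof.
have L20 : 0 < L ^+ 2 by rewrite exprn_gt0.
have Cr0 : 0 <= Crate by rewrite /Crate; have := K'_ge0; lra.
have Cg0 : 0 < Cangle by rewrite /Cangle; have := K'_ge0; lra.
pose Ca := Cangle + (L + 1) ^+ 2.
have Ca0 : 0 < Ca by rewrite ltr_wpDr ?sqr_ge0.
exists (Crate + Ca), (Num.min (8 * L)^-1 (Num.min 4^-1 Cangle^-1)); split.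
- exact: ltr_wpDl.
- by rewrite !lt_min !invr_gt0 mulr_gt0// Cg0 ltr0n.
move=> T N T0 N0 h; rewrite !le_min => /and3P[h8 h4 hC].
have h0 : 0 < h by rewrite divr_gt0// ltr0n.
have TE : T = N%:R * h by rewrite /h mulrC divfK ?gt_eqF// ltr0n.
clearbody h.
have {}h8 : 8 * L * h <= 1 by rewrite mulrC -(ler_pdivlMr _ _ (_ : 0 < 8 * L)) ?div1r// mulr_gt0.
have {}h4 : 4 * h <= 1 by rewrite mulrC -(ler_pdivlMr _ _ (_ : 0 < 4)) ?div1r ?ltr0n.
have {}hC : Cangle * h <= 1 by rewrite mulrC -(ler_pdivlMr _ _ Cg0) div1r.
rewrite /alpha1_diff -mulrBr normrM gtr0_norm ?invr_gt0//.
rewrite -ler_pdivlMl ?invr_gt0// invrK.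
have rate_lip s t : 0 <= s -> 0 <= t -> `|s - t| <= h ->
    `|turning_rate s - turning_rate t| <= Crate * `|s - t|.
  move=> s0 t0 st; apply: turning_rate_lip => //.
  by apply: le_trans h8; rewrite ler_wpM2l// mulr_ge0// ltW.
have int_err := right_riemann_sum_error Cr0 h0 rate_lip N.
have ang_err : `|\sum_(1 <= j < N.+1) h * turning_rate (j%:R * h) -
    \sum_(1 <= j < N.+1) vangle (x ((j%:R - 1) * h) - x (j%:R * h))
       (x (j%:R * h) - x ((j%:R + 1) * h))| <= N%:R * (Ca * h ^+ 2).
  rewrite -sumrB (le_trans (ler_norm_sum _ _ _))//.
  rewrite -[N in leRHS]subn0 -subSS mulr_natl -sumr_const_nat.
  rewrite big_nat_cond [leRHS]big_nat_cond ler_sum// => j; rewrite andbT => /andP[j1 _].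
  have hj : h <= j%:R * h by rewrite ler_peMl ?ler1n// ltW.
  have := chord_angle h0 hj h8 h4 hC.
  by rewrite distrC (mulrBl h) (mulrDl j%:R 1 h) mul1r.
rewrite {1}TE -(subrKA (\sum_(1 <= j < N.+1) h * turning_rate (j%:R * h))).
apply: (le_trans (ler_normD _ _)); apply: (le_trans (lerD int_err ang_err)).
by rewrite TE; apply: le_of_eq; ring.
Qed.

End CurveEstimates.

(** * Derivatives on bounded sets and along curves *)

Section BoundedDerivatives.
Context {R : realType} {d : nat}.
Implicit Types (t s r M : R) (p u v : 'cV[R]_d) (G : 'cV[R]_d -> 'cV[R]_d).

Lemma trmx_continuous m n : continuous (@trmx R m n).
Proof.
move=> A S /= /(nbhs_ballP A^T)[e /= e0 es].
apply/nbhs_ballP; exists e => //= B AB; apply: es.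
by case: AB => _ AB; split=> // i j; rewrite !mxE; exact: AB.
Qed.

Lemma enorm_le_norm p : enorm p <= d%:R * `|p|.
Proof.
apply: enorm_le_coord => i.
rewrite [leRHS]/Num.Def.normr/= mx_normrE.
exact: (le_bigmax _ (fun k : 'I_d * 'I_1 => `|p k.1 k.2|) (i, 0)).
Qed.

(** Compactness of closed balls is transported from row vectors by transposition. *)
Lemma continuous_ball_bounded G M : continuous G ->
  exists2 B, 0 <= B & forall p, `|p| <= M -> enorm (G p) <= B.
Proof.
move=> cG; pose A := [set q : 'rV[R]_d | `|q| <= M].
have cA : compact A.
  apply: bounded_closed_compact.
    by exists M; split; [exact: num_real|move=> N /ltW MN q /le_trans]; exact.
  have -> : A = (fun q : 'rV[R]_d => `|q|) @^-1` [set r | r <= M] by [].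
  by apply: closed_comp => [q _|]; [exact: norm_continuous|exact: closed_le].
have cGA : compact [set G q^T | q in A].
  apply: continuous_compact => //; apply: continuous_subspaceT => q.
  by apply: continuous_comp; [exact: trmx_continuous|exact: cG].
have [B0 [_ HB]] := compact_bounded cGA.
pose B := Num.max 0 (B0 + 1).
exists (d%:R * B) => [|p pM]; first by rewrite mulr_ge0// le_max lexx.
apply: (le_trans (enorm_le_norm _)); rewrite ler_wpM2l//.
apply: HB; first by rewrite lt_max ltrDl ltr01 orbT.
exists p^T; last by rewrite trmxK.
rewrite /A /= [leLHS]/Num.Def.normr/= mx_normrE.
apply: bigmax_le => [|[i j] _]; first exact: le_trans pM.
rewrite mxE (le_trans _ pM)// [leRHS]/Num.Def.normr/= mx_normrE.
exact: (le_bigmax _ (fun k : 'I_d * 'I_1 => `|p k.1 k.2|) (j, i)).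
Qed.

Lemma diffE_coord G p u : differentiable G p ->
  'd G p u = \sum_j u j 0 *: 'D_(delta_mx j 0) G p.
Proof.
move=> dG; rewrite [u in LHS]colv_sum_delta.
by rewrite linear_sum; apply: eq_bigr => j _; rewrite linearZ/= deriveE.
Qed.

Lemma enorm_lincomb_le u (F : 'I_d -> 'cV[R]_d) (c : 'I_d -> R) :
  (forall j, enorm (F j) <= c j) ->
  enorm (\sum_j u j 0 *: F j) <= (\sum_j c j) * enorm u.
Proof.
move=> Fc; apply: (le_trans (enorm_sum _ _ _)); rewrite mulr_suml ler_sum// => j _.
by rewrite enormZ mulrC ler_pM ?enorm_ge0// normr_coord_le.
Qed.

Lemma diff_ball_bounded G M : Ck 1 G ->
  exists2 L, 0 <= L & forall p u, `|p| <= M -> enorm ('d G p u) <= L * enorm u.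
Proof.
move=> [dG cG].
have /choice[c cP] j : exists B, 0 <= B /\
    forall p, `|p| <= M -> enorm ('D_(delta_mx j 0) G p) <= B.
  by have [B B0 HB] := continuous_ball_bounded M (cG (delta_mx j 0)); exists B.
exists (\sum_j c j) => [|p u pM]; first by rewrite sumr_ge0// => j _; have [] := cP j.
by rewrite diffE_coord//; apply: enorm_lincomb_le => j; have [_] := cP j; exact.
Qed.

Lemma primitive_comp G (x v : R -> 'cV[R]_d) : (forall p, differentiable G p) ->
  primitive_ge0 x v -> primitive_ge0 (G \o x) (fun t => 'd G (x t) (v t)).
Proof.
move=> dG [x0 dx]; split.
  exact: (cvg_comp x G x0 (differentiable_continuous (dG (x 0)))).
move=> t t0; have [dxt xt] := dx _ t0.
have dxt' : differentiable x t by exact/derivable1_diffP.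
apply: DeriveDef; first by apply/derivable1_diffP/differentiable_comp.
rewrite deriveE; last exact: differentiable_comp.
by rewrite diff_comp//= -xt deriveE.
Qed.

Lemma primitiveB (u u' v v' : R -> 'cV[R]_d) :
  primitive_ge0 u u' -> primitive_ge0 v v' ->
  primitive_ge0 (fun t => u t - v t) (fun t => u' t - v' t).
Proof.
move=> [u0 du] [v0 dv]; split=> [|t t0]; first exact: cvgB.
by have := du _ t0; have := dv _ t0 => ? ?; exact: is_deriveB.
Qed.

End BoundedDerivatives.

(** * Bounded solutions of the differential equation *)

Section Orbit.
Context {R : realType} {d : nat}.
Variables (f : 'cV[R]_d -> 'cV[R]_d) (x : R -> 'cV[R]_d).
Implicit Types (t s r : R) (u : 'cV[R]_d).
Hypothesis f_C2 : Ck 2 f.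
Hypothesis x_sol : is_solution f x.
Hypothesis x_bounded : [bounded x t | t in `[0, +oo[].

Let v t := f (x t).
Let w t := 'd f (x t) (v t).

Lemma position_primitive : primitive_ge0 x v.
Proof. exact: is_derive_ge0_primitive. Qed.

Lemma velocity_primitive : primitive_ge0 v w.
Proof. exact: (primitive_comp f_C2.1 position_primitive). Qed.

Lemma orbit_bounded : exists M, forall t, 0 <= t -> `|x t| <= M.
Proof.
have [M0 [_ HM]] := x_bounded.
exists (M0 + 1) => t t0; apply: HM; first by rewrite ltrDl.
by rewrite /= in_itv/= t0.
Qed.

Lemma Ck1_of_Ck2 : Ck 1 f.
Proof.
split=> [|u p]; first exact: f_C2.1.
exact: differentiable_continuous ((f_C2.2 u).1 p).
Qed.

Lemma variational_bounded :
  exists2 L, 0 < L & forall t u, 0 <= t -> enorm ('d f (x t) u) <= L * enorm u.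
Proof.
have [M xM] := orbit_bounded; have [L L0 HL] := diff_ball_bounded M Ck1_of_Ck2.
exists (L + 1) => [|t u t0]; first by rewrite ltr_wpDl.
by rewrite (le_trans (HL _ _ (xM _ t0)))// ler_wpM2r ?enorm_ge0// lerDl.
Qed.

(** [G \o x] has derivative ['d G (x t) (f (x t))], and both factors are bounded
on the bounded orbit. *)
Lemma lipschitz_along_orbit (G : 'cV[R]_d -> 'cV[R]_d) : Ck 1 G ->
  exists K, 0 <= K /\ forall s t, 0 <= s -> 0 <= t ->
    enorm (G (x s) - G (x t)) <= K * `|s - t|.
Proof.
move=> G1; have [M xM] := orbit_bounded; have [L L0 HL] := diff_ball_bounded M G1.
have f_cont : continuous f by move=> p; exact: differentiable_continuous (f_C2.1 p).
have [V V0 HV] := continuous_ball_bounded M f_cont.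
exists (L * V); split=> [|s t s0 t0]; first exact: mulr_ge0.
have := @mean_value_enorm_sym _ _ _ _ t s (L * V) 0 0
  (primitive_comp G1.1 position_primitive) t0 s0.
rewrite !scaler0 !subr0; apply => r r0 _; rewrite scaler0 !subr0.
by rewrite (le_trans (HL _ _ (xM _ r0)))// ler_wpM2l// HV// xM.
Qed.

(** The second derivatives of [f] enter here, through the partial derivatives of
[f] along the orbit. *)
Lemma variational_lipschitz :
  exists2 K, 0 <= K & forall s t u, 0 <= s -> 0 <= t ->
    enorm ('d f (x s) u - 'd f (x t) u) <= K * `|s - t| * enorm u.
Proof.
have /choice[c cP] (j : 'I_d) := lipschitz_along_orbit (f_C2.2 (delta_mx j 0)).
exists (\sum_j c j) => [|s t u s0 t0]; first by rewrite sumr_ge0// => j _; have [] := cP j.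
have e r := diffE_coord u (f_C2.1 (x r)).
have -> : 'd f (x s) u - 'd f (x t) u =
    \sum_j u j 0 *: ('D_(delta_mx j 0) f (x s) - 'D_(delta_mx j 0) f (x t)).
  under eq_bigr do rewrite scalerBr.
  by rewrite sumrB; congr (_ - _); exact: e.
by rewrite mulr_suml; apply: enorm_lincomb_le => j; have [_] := cP j; exact.
Qed.

Lemma acceleration_dist L K :
  (forall t u, 0 <= t -> enorm ('d f (x t) u) <= L * enorm u) ->
  (forall s t u, 0 <= s -> 0 <= t ->
    enorm ('d f (x s) u - 'd f (x t) u) <= K * `|s - t| * enorm u) ->
  forall s t, 0 <= s -> 0 <= t ->
  enorm (w s - w t) <= K * `|s - t| * enorm (v s) + L * enorm (v s - v t).
Proof.
move=> HL HK s t s0 t0.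
rewrite -(subrKA ('d f (x t) (v s))) (le_trans (enormD _ _))// lerD//; first exact: HK.
by rewrite /w -linearB HL.
Qed.

(** The velocity solves the variational equation, so by the backward Gronwall
inequality a zero of it would make [x] constant. *)
Lemma velocity_neq0 : (exists s t, [/\ 0 <= s, 0 <= t & x s <> x t]) ->
  forall t, 0 <= t -> v t != 0.
Proof.
move=> [s1 [s2 [s10 s20 xs]]] t t0; apply/eqP => vt0; apply: xs.
have [L _ HL] := variational_bounded.
have v0 r : 0 <= r -> enorm (v r) <= 0.
  move=> r0; have := gronwall velocity_primitive (fun t => HL t (v t)) t0 r0.
  by rewrite vt0 enorm0 expr0n/= mulr0 exprn_even_le0//= => /eqP ->.
have := @mean_value_enorm_sym _ _ x v s2 s1 0 0 0 position_primitive s20 s10.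
rewrite !scaler0 !subr0 mul0r => h.
apply/eqP; rewrite -subr_eq0 -[_ == 0]negbK -enorm_gt0 -leNgt h// => r r0 _.
by rewrite scaler0 !subr0 v0.
Qed.

(** Both sides solve the variational equation with the same initial value. *)
Lemma solution_operator_velocity (Phi : R -> R -> 'End('cV[R]_d)) t :
  is_solution_operator (variational f x) Phi -> 0 <= t ->
  Phi t 0 (v 0) = v t.
Proof.
move=> /(_ 0 (v 0) (lexx _)) [Phi0 dPhi] t0.
have := primitiveB (is_derive_ge0_primitive dPhi) velocity_primitive.
have [L _ HL] := variational_bounded.
set y' := (X in primitive_ge0 _ X) => py.
have y'L s : 0 <= s -> enorm (y' s) <= L * enorm (Phi s 0 (v 0) - v s).
  by move=> s0; rewrite /y' /variational lfunE/= /w -linearB HL.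
have := gronwall py y'L (lexx _) t0.
rewrite Phi0 subrr enorm0 expr0n/= mulr0 exprn_even_le0//= => /eqP e0.
by apply/eqP; rewrite -subr_eq0 -[_ == 0]negbK -enorm_gt0 e0 ltxx.
Qed.

Lemma alpha1_cont_turning (Phi : R -> R -> 'End('cV[R]_d)) T :
  (forall t, 0 <= t -> v t != 0) ->
  is_solution_operator (variational f x) Phi ->
  alpha1_cont (variational f x) Phi T <[derive_ge0 x 0]>%VS =
  T^-1 * \int[lebesgue_measure]_(t in `[0, T]) turning_rate v w t.
Proof.
move=> v0 Phi_sol; rewrite /alpha1_cont (derive_ge0_val (x_sol (lexx _))).
congr (_ * _); apply: eq_Rintegral => t; rewrite inE/= in_itv/= => /andP[t0 _].
rewrite limg_line (solution_operator_velocity Phi_sol t0) opnorm_cross ?v0//.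
by rewrite /variational lfunE.
Qed.

End Orbit.

Unset Implicit Arguments.
Set Strict Implicit.

Theorem theorem4p9 (R : realType) (d : nat)
    (f : 'cV[R]_d -> 'cV[R]_d) (x : R -> 'cV[R]_d)
    (Phi : R -> R -> 'End('cV[R]_d))
    (f_C2 : Ck 2 f)
    (x_sol : is_solution f x)
    (x_bounded : [bounded x t | t in `[0, +oo[])
    (x_nonconstant : exists s t, [/\ 0 <= s, 0 <= t & x s <> x t])
    (Phi_sol : is_solution_operator (variational f x) Phi) :
  let V0 := <[derive_ge0 x 0]>%VS in
  exists C h0 : R, [/\ 0 < C, 0 < h0 &
    forall (T : R) (N : nat), 0 < T -> (0 < N)%N ->
      let h := T / N%:R in
      h <= h0 ->
      `|alpha1_cont (variational f x) Phi T V0 - alpha1_diff x h T N|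
        <= C * h].
Proof.
have [L L0 HL] := variational_bounded f_C2 x_bounded.
have [K K0 HK] := variational_lipschitz f_C2 x_sol x_bounded.
have v0 := velocity_neq0 f_C2 x_sol x_bounded x_nonconstant.
have wL t : 0 <= t -> enorm ('d f (x t) (f (x t))) <= L * enorm (f (x t)) by exact: HL.
have [C [h0 [C0 h00 H]]] := mean_turning_rate_discretization L0 K0
  (position_primitive x_sol) (velocity_primitive f_C2 x_sol) v0 wL (acceleration_dist HL HK).
exists C, h0; split=> // T N T0 N0 h hh0.
rewrite (alpha1_cont_turning f_C2 x_sol x_bounded T v0 Phi_sol); exact: H.
Qed.
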